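(* Let $d\ge 3$ be an integer. For all real numbers $a,b$ with $0<a<b$ there exist a number $l$ with $a<l<b$ and a graph $G$ such that $G$ is a unit distance $d$-dimensional rod of length $l$.
   Context: A weighted graph $G=(V,E,w)$ is a finite simple graph with edge lengths $w:E\to\mathbb{R}_{>0}$; it is a unit distance graph if $w\equiv1$. An embedding of $G$ in $\mathbb{R}^d$ is a map $\varphi:V\to\mathbb{R}^d$ with $\|\varphi(x)-\varphi(y)\|=w((x,y))$ for every edge $(x,y)$. An embedding is non-critical if it is injective, no two non-adjacent vertices are mapped at distance exactly $1$, and no three vertices are mapped onto a common straight line. $G$ is a $d$-dimensional rod of length $l$ if there exist vertices $u,v$ such that in every embedding of $G$ in $\mathbb{R}^d$ the images of $u,v$ are at distance $l$, and $G$ has a non-critical embedding in $\mathbb{R}^d$. A unit distance rod is a rod which is a unit distance graph. *)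

(* Defs.v *)
From HB Require Import structures.
From mathcomp Require Import all_boot all_order all_algebra.
From mathcomp Require Import reals.

Set Implicit Arguments.
Unset Strict Implicit.
Unset Printing Implicit Defensive.

Import Order.TTheory GRing.Theory Num.Theory.
Local Open Scope ring_scope.

(* The lengths are given on ordered pairs of vertices; only the values at      *)
(* adjacent pairs matter.                                                      *)
Record wgraph (R : realType) := WGraph {
  vertex :> finType;
  adj : rel vertex;
  weight : vertex -> vertex -> R;
  adj_sym : symmetric adj;
  adj_irr : irreflexive adj;
  weight_sym : forall x y, adj x y -> weight x y = weight y x;
  weight_gt0 : forall x y, adj x y -> 0 < weight x y
}.

Section Rods.

Variables (R : realType) (d : nat).

Definition unit_distance (G : wgraph R) : Prop :=
  forall x y : G, adj x y -> weight x y = 1.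

(* Euclidean distance; the norm that the libraries put on 'rV[R]_d is the      *)
(* sup norm.                                                                   *)
Definition edist (p q : 'rV[R]_d) : R :=
  Num.sqrt (\sum_(i < d) (p ord0 i - q ord0 i) ^+ 2).

Definition on_line (p v q : 'rV[R]_d) : Prop := exists t : R, q = p + t *: v.

Definition collinear (q1 q2 q3 : 'rV[R]_d) : Prop :=
  exists p v : 'rV[R]_d,
    [/\ v != 0, on_line p v q1, on_line p v q2 & on_line p v q3].

Definition embedding (G : wgraph R) (phi : G -> 'rV[R]_d) : Prop :=
  forall x y : G, adj x y -> edist (phi x) (phi y) = weight x y.

Definition non_critical (G : wgraph R) (phi : G -> 'rV[R]_d) : Prop :=
  [/\ injective phi,
      forall x y : G, x != y -> ~~ adj x y -> edist (phi x) (phi y) <> 1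
    & forall x y z : G, x != y -> y != z -> x != z ->
        ~ collinear (phi x) (phi y) (phi z)].

Definition rod (G : wgraph R) (l : R) : Prop :=
  (exists u v : G, forall phi : G -> 'rV[R]_d,
     embedding phi -> edist (phi u) (phi v) = l)
  /\ (exists phi : G -> 'rV[R]_d, embedding phi /\ non_critical phi).

Definition unit_distance_rod (G : wgraph R) (l : R) : Prop :=
  rod G l /\ unit_distance G.

End Rods.

(* Main.v *)
Require Import Defs.
From mathcomp Require Import all_boot all_order all_algebra.
From mathcomp Require Import reals boolp classical_sets.
From mathcomp Require Import ring lra.

Set Implicit Arguments.
Unset Strict Implicit.
Unset Printing Implicit Defensive.

Import Order.TTheory GRing.Theory Num.Theory.
Local Open Scope ring_scope.

(** A unit distance graph with a non-critical embedding is the same thing as a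
    finite set of points of the space, no three of them collinear, two points
    being adjacent when their distance is 1.  Accidental coincidences and unit
    distances between parts of such a set only add constraints, so when two
    point sets are glued along a pair of points at equal distances, only
    collinear triples have to be avoided; as [d >= 3], a generic reflection in
    a hyperplane through the pair does it.  Hence pairs of points of any
    configuration without collinear triples can be held at a distance which is
    the length of a rod.

    The apexes of a bipyramid over a regular simplex with [d] vertices, with
    squared edge lengths [A] (at the apexes) and [B] (in the base), are at
    squared distance [0] or [D = 4 A - 2 (1 - 1/d) B].  Two such bipyramids with
    a common apex and with their other apexes held at a squared distance
    [r < 4 D], [r != D], cannot be folded, so [D] is the square of the length of
    a rod when [A], [B] and [r] are.  Writing [m = 2 (d + 1) / d], the choice
    [A = B = r = s] gives [D = m s], and [A = m^k s], [B = m^(k+1) s], [r = s]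
    gives [D = e s] with [e = 4 m^k / d^2]; some [k] has [1/4 < e < 1].  The
    numbers [e^i m^j] are dense in the positive reals because [e < 1 < m] and
    [e], [m] are multiplicatively independent. *)

(** * Genericity: functions polynomial along every line *)

Section PolynomialOnLines.

Variables (R : realType) (d : nat).
Implicit Types (f g : 'rV[R]_d -> R) (x y n e : 'rV[R]_d).

(** In characteristic 0 the first [size p] natural numbers are distinct, too many to be all
    roots. *)
Lemma exists_nonroot (p : {poly R}) : p != 0 -> exists t, p.[t] != 0.
Proof.
move=> p0; pose s := [seq i%:R : R | i <- iota 0 (size p)].
have us : uniq s by rewrite map_inj_uniq ?iota_uniq//; exact: mulrIn (oner_neq0 R).
have [/allP ps|/allPn[t _ pt]] := boolP (all (root p) s); last by exists t.
have := max_poly_roots p0 (introT allP ps) us.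
by rewrite size_map size_iota ltnn.
Qed.

(** This stands in for multivariate polynomials: the genericity argument only restricts functions to
    lines. *)
Definition poly_on_lines f :=
  forall x y, exists p : {poly R}, forall t, f (x + t *: y) = p.[t].

Lemma poly_on_lines_cst (c : R) : poly_on_lines (fun=> c).
Proof. by move=> x y; exists c%:P => t; rewrite hornerC. Qed.

Lemma poly_on_lines_coord i : poly_on_lines (fun x => x ord0 i).
Proof.
move=> x y; exists ((x ord0 i)%:P + 'X * (y ord0 i)%:P) => t.
by rewrite !mxE !hornerE.
Qed.

Lemma poly_on_linesM f g :
  poly_on_lines f -> poly_on_lines g -> poly_on_lines (fun x => f x * g x).
Proof.
move=> hf hg x y; have [[p hp] [q hq]] := (hf x y, hg x y).
by exists (p * q) => t; rewrite hp hq hornerE.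
Qed.

Lemma poly_on_linesB f g :
  poly_on_lines f -> poly_on_lines g -> poly_on_lines (fun x => f x - g x).
Proof.
move=> hf hg x y; have [[p hp] [q hq]] := (hf x y, hg x y).
by exists (p - q) => t; rewrite hp hq !hornerE.
Qed.

Lemma poly_on_lines_sum (I : Type) (r : seq I) (F : I -> 'rV[R]_d -> R) :
  (forall i, poly_on_lines (F i)) -> poly_on_lines (fun x => \sum_(i <- r) F i x).
Proof.
move=> hF; elim: r => [|i r IH] x y.
  by exists 0 => t; rewrite big_nil hornerE.
have [[p hp] [q hq]] := (hF i x y, IH x y).
by exists (p + q) => t; rewrite big_cons hp hq hornerE.
Qed.

(** Induction on [r]: join a point good for the tail to a point good for the head. On this line,
    which stays in [W], the head and the product of the tail are nonzero polynomials, so some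
    parameter avoids the roots of both. *)
Lemma generic_nonzero (W : 'rV[R]_d -> Prop) (I : eqType) (r : seq I)
    (F : I -> 'rV[R]_d -> R) :
  (exists x, W x) -> (forall x y t, W x -> W y -> W (x + t *: (y - x))) ->
  (forall i, poly_on_lines (F i)) ->
  (forall i, i \in r -> exists2 x, W x & F i x != 0) ->
  exists2 x, W x & forall i, i \in r -> F i x != 0.
Proof.
move=> [w Ww] Wl polyF; elim: r => [|i r IH] Fr; first by exists w.
have [x Wx Fx] := IH (fun j jr => Fr j (@mem_behead _ (i :: r) _ jr)).
have [y Wy Fy] := Fr i (mem_head _ _).
have poly_prod : poly_on_lines (fun z => \prod_(j <- r) F j z).
  elim: (r) => [|j l IHl] a b; first by exists 1 => t; rewrite big_nil hornerE.
  have [[p hp] [q hq]] := (polyF j a b, IHl a b).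
  by exists (p * q) => t; rewrite big_cons hp hq hornerE.
have [p hp] := polyF i x (y - x).
have [q hq] := poly_prod x (y - x).
have p0 : p != 0.
  apply: contraNneq Fy => p0; have := hp 1.
  by rewrite scale1r addrC subrK p0 horner0 => ->.
have q0 : q != 0.
  have := hq 0; rewrite scale0r addr0 => /eqP h; apply/eqP => q0.
  move: h; rewrite q0 horner0 prodf_seq_eq0 => /hasP[j jr /=].
  by rewrite (negPf (Fx j jr)).
have [t] := @exists_nonroot (p * q) (mulf_neq0 p0 q0).
rewrite hornerM mulf_eq0 negb_or -hp -hq prodf_seq_neq0 => /andP[Fi /allP Fj].
exists (x + t *: (y - x)); first exact: Wl.
by move=> j; rewrite inE => /orP[/eqP->//|/Fj].
Qed.

End PolynomialOnLines.

(** * Inner product, collinearity and reflections in hyperplanes *)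

Section EuclideanGeometry.

Variables (R : realType) (d : nat).
Implicit Types (p q u v w x y z n e : 'rV[R]_d) (X Y : seq 'rV[R]_d).

Definition dot x y : R := \sum_(i < d) x ord0 i * y ord0 i.

Lemma dotC x y : dot x y = dot y x.
Proof. by apply: eq_bigr => i _; rewrite mulrC. Qed.

Lemma dotDl x y z : dot (x + y) z = dot x z + dot y z.
Proof. by rewrite -big_split; apply: eq_bigr => i _; rewrite mxE mulrDl. Qed.

Lemma dotZl c x y : dot (c *: x) y = c * dot x y.
Proof. by rewrite mulr_sumr; apply: eq_bigr => i _; rewrite mxE mulrA. Qed.

Lemma dotNl x y : dot (- x) y = - dot x y.
Proof. by rewrite -scaleN1r dotZl mulN1r. Qed.

Lemma dotDr x y z : dot z (x + y) = dot z x + dot z y.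
Proof. by rewrite dotC dotDl !(dotC _ z). Qed.

Lemma dotZr c x y : dot x (c *: y) = c * dot x y.
Proof. by rewrite dotC dotZl (dotC x). Qed.

Lemma dotNr x y : dot x (- y) = - dot x y.
Proof. by rewrite dotC dotNl (dotC x). Qed.

Lemma dot0l x : dot 0 x = 0.
Proof. by rewrite -(scale0r 0) dotZl mul0r. Qed.

Lemma dot0r x : dot x 0 = 0.
Proof. by rewrite dotC dot0l. Qed.

Definition dotE := (dotDl, dotDr, dotNl, dotNr, dotZl, dotZr).

Lemma dotxx_ge0 x : 0 <= dot x x.
Proof. by apply: sumr_ge0 => i _; rewrite -expr2 sqr_ge0. Qed.

Lemma dotxx_eq0 x : (dot x x == 0) = (x == 0).
Proof.
apply/eqP/eqP => [|->]; last exact: dot0l.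
move/eqP; rewrite psumr_eq0 => [/allP x0|i _]; last by rewrite -expr2 sqr_ge0.
apply/rowP => i; rewrite mxE; apply/eqP.
by have := x0 i (mem_index_enum _); rewrite mulf_eq0 orbb.
Qed.

Definition sqd x y : R := dot (x - y) (x - y).

Lemma sqdC x y : sqd x y = sqd y x.
Proof. by rewrite /sqd -(opprB y) dotNl dotNr opprK. Qed.

Lemma sqd_eq0 x y : (sqd x y == 0) = (x == y).
Proof. by rewrite dotxx_eq0 subr_eq0. Qed.

Lemma sqd_ge0 x y : 0 <= sqd x y.
Proof. exact: dotxx_ge0. Qed.

Lemma edistE x y : edist x y = Num.sqrt (sqd x y).
Proof. by congr Num.sqrt; apply: eq_bigr => i _; rewrite !mxE expr2. Qed.

(* By Heron's formula this is sixteen times the squared area of the triangle. *)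
Definition gap x y z : R :=
  4 * sqd x y * sqd x z - (sqd x y + sqd x z - sqd y z) ^+ 2.

Lemma gapCr x y z : gap x y z = gap x z y.
Proof. by rewrite /gap (sqdC z y); ring. Qed.

Lemma gapCl x y z : gap x y z = gap y x z.
Proof. by rewrite /gap (sqdC y x); ring. Qed.

Lemma gapE x y z :
  gap x y z = 4 * (dot (x - y) (x - y) * dot (z - y) (z - y)
                   - dot (x - y) (z - y) ^+ 2).
Proof.
rewrite /gap /sqd !dotE (dotC y x) (dotC z x) (dotC z y); ring.
Qed.

(** This is the equality case of Cauchy-Schwarz: the component of [x - y] orthogonal to [z - y] has
    norm 0. *)
Lemma gap_eq0_line x y z : y != z -> gap x y z = 0 ->
  exists t, x = y + t *: (z - y).
Proof.
rewrite eq_sym -subr_eq0 -dotxx_eq0 => yz /eqP; rewrite gapE mulf_eq0 pnatr_eq0 /=.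
move: (x - y) (subrK y x) (z - y) yz => a <- b b0 /eqP h.
exists (dot a b / dot b b); rewrite addrC; congr (_ + _); apply/eqP.
rewrite -subr_eq0 -dotxx_eq0 !dotE (dotC b a).
apply/eqP; transitivity ((dot a a * dot b b - dot a b ^+ 2) / dot b b).
  by field.
by rewrite h mul0r.
Qed.

Lemma collinear_gap x y z : collinear x y z -> gap x y z = 0.
Proof.
case=> p [v [_ [a ->] [b ->] [c ->]]]; rewrite gapE.
have lineB s t : p + s *: v - (p + t *: v) = (s - t) *: v.
  by rewrite opprD addrACA subrr add0r scalerBl.
rewrite !lineB !dotE; ring.
Qed.

(* For [n = 0] division by zero makes this the identity. *)
Definition refl n x := x - (2 * dot n x / dot n n) *: n.

Lemma refl_dot n x y : dot (refl n x) (refl n y) = dot x y.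
Proof.
rewrite /refl !dotE (dotC x n).
have [->|n0] := eqVneq n 0; first by rewrite !dot0l; ring.
by field; rewrite dotxx_eq0.
Qed.

Lemma reflB n x y : refl n (x - y) = refl n x - refl n y.
Proof.
by rewrite /refl dotDr dotNr; apply/rowP => i; rewrite !mxE; ring.
Qed.

Lemma refl_orth n x : dot n x = 0 -> refl n x = x.
Proof. by move=> h; rewrite /refl h mulr0 mul0r scale0r subr0. Qed.

Lemma reflK n : involutive (refl n).
Proof.
move=> x; have [->|n0] := eqVneq n 0; first by rewrite /refl !scaler0 !subr0.
rewrite {1}/refl {2}/refl !dotE -addrA -opprD -scalerDl.
rewrite -[RHS]subr0; congr (_ - _); rewrite -[RHS](scale0r n); congr (_ *: _).
by rewrite /refl; field; rewrite dotxx_eq0.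
Qed.

Lemma refl_swap x y : dot x x = dot y y -> refl (x - y) x = y.
Proof.
move=> xy; have [->|n0] := eqVneq x y; first by rewrite refl_orth ?subrr ?dot0l.
have e : 2 * dot (x - y) x / dot (x - y) (x - y) = 1.
  have : dot (x - y) (x - y) != 0 by rewrite dotxx_eq0 subr_eq0.
  rewrite !dotE (dotC y x) -xy => h; field.
  by move: h; apply: contraNneq => h; rewrite -h; apply/eqP; ring.
by rewrite /refl e scale1r opprB addrC subrK.
Qed.

Definition reflect_at p n x := p + refl n (x - p).

Lemma reflect_atB p n x y : reflect_at p n x - reflect_at p n y = refl n (x - y).
Proof.
rewrite /reflect_at opprD addrACA subrr add0r -reflB; congr refl.
by rewrite opprB addrA subrK.
Qed.

Lemma reflect_at_sqd p n x y : sqd (reflect_at p n x) (reflect_at p n y) = sqd x y.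
Proof. by rewrite /sqd reflect_atB refl_dot. Qed.

Lemma reflect_at_fix p n x : dot n (x - p) = 0 -> reflect_at p n x = x.
Proof. by move=> h; rewrite /reflect_at refl_orth // addrC subrK. Qed.

Lemma reflect_at_center p n : reflect_at p n p = p.
Proof. by rewrite reflect_at_fix // subrr dot0r. Qed.

Lemma reflect_atK p n : involutive (reflect_at p n).
Proof.
move=> x; rewrite /reflect_at (_ : p + _ - p = refl n (x - p)) ?reflK; last first.
  by rewrite addrC addKr.
by rewrite addrC subrK.
Qed.

Lemma exists_orthogonal x y : (2 < d)%N ->
  exists w, [/\ w != 0, dot w x = 0 & dot w y = 0].
Proof.
move=> d3; pose A : 'M[R]_(2, d) := col_mx x y.
have /rowV0Pn[w /sub_kermxP wA w0] : kermx A^T != 0.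
  rewrite -mxrank_eq0 mxrank_ker -lt0n subn_gt0.
  by apply: leq_ltn_trans d3; rewrite rank_leq_col.
have wE (i : 'I_(1 + 1)) : \sum_(j < d) w ord0 j * A i j = 0.
  transitivity ((w *m A^T) ord0 i); last by rewrite wA mxE.
  by rewrite [RHS]mxE; apply: eq_bigr => j _; rewrite [A^T _ _]mxE.
exists w; split=> //.
  rewrite -[RHS](wE (lshift 1 ord0)); apply: eq_bigr => j _.
  by rewrite [A _ _](@col_mxEu _ 1 1).
rewrite -[RHS](wE (rshift 1 ord0)); apply: eq_bigr => j _.
by rewrite [A _ _](@col_mxEd _ 1 1).
Qed.

Lemma poly_on_lines_dot (F G : 'rV[R]_d -> 'rV[R]_d) :
  (forall i, poly_on_lines (fun n => F n ord0 i)) ->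
  (forall i, poly_on_lines (fun n => G n ord0 i)) ->
  poly_on_lines (fun n => dot (F n) (G n)).
Proof. by move=> hF hG; apply: poly_on_lines_sum => i; apply: poly_on_linesM. Qed.

(* The images of [z] under the reflections fixing the line [pq] contain three  *)
(* points of a circle, and no line meets a circle in three points.             *)
Lemma exists_reflection_off_line p q x y z : (2 < d)%N ->
  p != q -> x != y -> gap z p q != 0 ->
  exists n, [/\ n != 0, dot n (q - p) = 0 & gap (reflect_at p n z) x y != 0].
Proof.
move=> d3 pq xy zpq; move: zpq; rewrite gapE.
have : dot (q - p) (q - p) != 0 by rewrite dotxx_eq0 subr_eq0 eq_sym.
rewrite /reflect_at; move: (q - p) (z - p) => e z0 e0 zpq.
have [c [w [ez0 we]]] : exists c w, z0 = w + c *: e /\ dot w e = 0.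
  exists (dot z0 e / dot e e), (z0 - (dot z0 e / dot e e) *: e).
  by rewrite subrK; split=> //; rewrite !dotE; field.
have w0 : w != 0.
  apply: contraNneq zpq => w0; rewrite ez0 w0 add0r !dotE.
  by apply/eqP; ring.
(* Dimension at least 3 leaves a second direction [w'] normal to the line. The three reflections
   have normals [w'], [w] and [w + w']. *)
have [w' [w'0 w'e w'w]] := exists_orthogonal e w d3.
have ww0 : 0 < dot w w by rewrite lt_neqAle eq_sym dotxx_eq0 w0 dotxx_ge0.
have ww'0 : 0 < dot w' w' by rewrite lt_neqAle eq_sym dotxx_eq0 w'0 dotxx_ge0.
have ew : dot e w = 0 by rewrite dotC.
have nz0 n : dot n e = 0 -> dot n z0 = dot n w.
  by move=> ne; rewrite ez0 !dotE ne mulr0 addr0.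
have d1 : p + refl w' z0 = p + z0 by rewrite refl_orth // nz0.
have d2 : p + refl w z0 = p + z0 - 2 *: w.
  rewrite /refl nz0 // mulfK ?gt_eqF // addrA //.
have d3' : p + refl (w + w') z0
    = p + z0 - (2 * dot w w / (dot w w + dot w' w')) *: (w + w').
  rewrite /refl nz0; last by rewrite dotDl we w'e addr0.
  by rewrite !dotE w'w (dotC w w') w'w !addr0 add0r addrA.
have [h1|h1] := eqVneq (gap (p + refl w' z0) x y) 0; last by exists w'.
have [h2|h2] := eqVneq (gap (p + refl w z0) x y) 0; last by exists w.
exists (w + w'); split.
- rewrite -dotxx_eq0 !dotE w'w (dotC w w') w'w addr0 add0r.
  by rewrite gt_eqF // addr_gt0.
- by rewrite dotDl we w'e addr0.
apply/eqP => h3.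
have [t1 e1] := gap_eq0_line xy h1.
have [t2 e2] := gap_eq0_line xy h2.
have [t3 e3] := gap_eq0_line xy h3.
have lineB s t : x + s *: (y - x) - (x + t *: (y - x)) = (s - t) *: (y - x).
  by rewrite opprD addrACA subrr add0r scalerBl.
have E2 : 2 *: w = (t1 - t2) *: (y - x).
  by rewrite -lineB -e1 -e2 d1 d2 subKr.
have E3 : (2 * dot w w / (dot w w + dot w' w')) *: (w + w') = (t1 - t3) *: (y - x).
  by rewrite -lineB -e1 -e3 d1 d3' subKr.
(* Paired with [w'], [E3] shows that [y - x] is not orthogonal to [w']; then [E2] gives [t1 = t2],
   hence [w = 0]. *)
have F3 := congr1 (dot w') E3; have F2 := congr1 (dot w') E2.
rewrite !dotZr w'w mulr0 in F2; rewrite !dotZr dotDr w'w add0r in F3.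
have yx0 : dot w' (y - x) != 0.
  apply/eqP => h; move: F3; rewrite h mulr0 => /eqP.
  by rewrite gt_eqF // mulr_gt0 // divr_gt0 ?addr_gt0 // mulr_gt0.
move/esym/eqP: F2; rewrite mulf_eq0 (negPf yx0) orbF => /eqP t12.
move/eqP: E2; rewrite t12 scale0r scaler_eq0 pnatr_eq0 /=.
by rewrite (negPf w0).
Qed.

End EuclideanGeometry.

(** * Gluing point sets without collinear triples *)

Section Gluing.

Variables (R : realType) (d : nat).
Hypothesis d3 : (2 < d)%N.
Implicit Types (p q u v w x y z n e : 'rV[R]_d) (P X Y : seq 'rV[R]_d).
Implicit Types (phi g : 'rV[R]_d -> 'rV[R]_d).

Definition general X := forall x y z, x \in X -> y \in X -> z \in X ->
  x != y -> x != z -> y != z -> gap x y z != 0.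

Lemma general_map g X : (forall x y, sqd (g x) (g y) = sqd x y) ->
  general X -> general (map g X).
Proof.
move=> iso gX _ _ _ /mapP[x xX ->] /mapP[y yX ->] /mapP[z zX ->].
by rewrite -!sqd_eq0 /gap !iso !sqd_eq0; apply: gX.
Qed.

Lemma generic_reflection p q (T : seq ('rV[R]_d * 'rV[R]_d * 'rV[R]_d)) :
  p != q ->
  (forall z x y, (z, x, y) \in T -> x != y /\ gap z p q != 0) ->
  exists2 n, dot n (q - p) = 0 &
    forall z x y, (z, x, y) \in T -> gap (reflect_at p n z) x y != 0.
Proof.
move=> pq hT.
(* The reflection is rational in [n]; multiplying by [dot n n] makes it polynomial. [F] is the
   resulting Gram determinant. It vanishes at [n = 0], so a generic [n] is automatically nonzero. *)
pose Z (t : 'rV[R]_d * 'rV[R]_d * 'rV[R]_d) n :=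
  dot n n *: (p + (t.1.1 - p) - t.1.2) - (2 * dot n (t.1.1 - p)) *: n.
pose F t n := dot (Z t n) (Z t n) * dot (t.2 - t.1.2) (t.2 - t.1.2)
              - dot (Z t n) (t.2 - t.1.2) * dot (Z t n) (t.2 - t.1.2).
have FE t n : n != 0 ->
    4 * F t n = dot n n ^+ 2 * gap (reflect_at p n t.1.1) t.1.2 t.2.
  rewrite -dotxx_eq0 => n0.
  have ZE : Z t n = dot n n *: (reflect_at p n t.1.1 - t.1.2) :> 'rV[R]_d.
    rewrite /Z /reflect_at /refl; apply/rowP => i; rewrite !mxE; field.
    exact: n0.
  by rewrite /F ZE gapE; move: (reflect_at _ _ _ - _) (t.2 - _) => a b; rewrite !dotE; ring.
have F0 t : F t 0 = 0.
  by rewrite /F /Z !dot0l scale0r scaler0 subrr !dot0l; ring.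
have polydot x : poly_on_lines (fun n => dot n x).
  by apply: poly_on_lines_dot => i; [exact: poly_on_lines_coord|exact: poly_on_lines_cst].
have polyZ t i : poly_on_lines (fun n => Z t n ord0 i).
  have : poly_on_lines (fun n => dot n n * (p + (t.1.1 - p) - t.1.2) ord0 i
                          - 2 * dot n (t.1.1 - p) * n ord0 i).
    apply: poly_on_linesB; apply: poly_on_linesM.
    - by apply: poly_on_lines_dot => j; exact: poly_on_lines_coord.
    - exact: poly_on_lines_cst.
    - by apply: poly_on_linesM; [exact: poly_on_lines_cst|exact: polydot].
    - exact: poly_on_lines_coord.
  move=> h x y; have [r hr] := h x y; exists r => s; rewrite -hr.
  by rewrite /Z mxE [in LHS]mxE [X in _ + X = _]mxE [X in _ - X = _]mxE.
have polyF t : poly_on_lines (F t).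
  apply: poly_on_linesB; apply: poly_on_linesM;
    by [exact: poly_on_lines_cst
       |apply: poly_on_lines_dot => i; [|try exact: poly_on_lines_cst]; exact: polyZ].
have [||//|t tT|n nW nT] := @generic_nonzero _ _ (fun n => dot n (q - p) = 0) _ T F.
- by exists 0; rewrite dot0l.
- by move=> x y s hx hy; rewrite dotDl dotZl dotDl dotNl hx hy; ring.
- case: t tT => -[z x] y /hT[xy zpq].
  have [n [n0 ne h]] := exists_reflection_off_line d3 pq xy zpq.
  exists n => //; apply: contraNneq h => h.
  have := FE (z, x, y) n n0; rewrite h mulr0 => /esym/eqP.
  by rewrite mulf_eq0 sqrf_eq0 dotxx_eq0 (negPf n0) /= => /eqP ->.
exists n => // z x y /nT h; have n0 : n != 0 by apply: contraNneq h => ->; rewrite F0.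
have := FE (z, x, y) n n0 => /= FE'; apply: contraNneq h => h.
by move/eqP: FE'; rewrite h mulr0 mulf_eq0 pnatr_eq0.
Qed.

(** Points of either set other than [p] and [q] lie off the line through them, so a generic
    reflection moves them away from the lines to be avoided. As [p] and [q] are fixed, a mixed
    triple whose isolated point is one of them lies in a single set. *)
Lemma glue_aligned p q X Y : p != q -> general X -> general Y ->
  p \in X -> q \in X -> p \in Y -> q \in Y ->
  exists n, dot n (q - p) = 0 /\ general (X ++ map (reflect_at p n) Y).
Proof.
move=> pq gX gY pX qX pY qY.
pose Z := X ++ Y.
pose T := [seq t <- [seq (zx, y) | zx <- [seq (z, x) | z <- Z, x <- Z], y <- Z]
          | (t.1.2 != t.2) && (gap t.1.1 p q != 0)].
have inT z x y : z \in Z -> x \in Z -> y \in Z -> x != y -> gap z p q != 0 ->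
    (z, x, y) \in T.
  move=> zZ xZ yZ xy zpq; rewrite mem_filter /= xy zpq /=.
  by apply: allpairs_f => //; apply: allpairs_f.
have [z x y|n ne nT] := @generic_reflection p q T pq.
  by rewrite mem_filter => /andP[/andP[]].
exists n; split=> //.
have sp : reflect_at p n p = p := reflect_at_center p n.
have sq : reflect_at p n q = q := reflect_at_fix ne.
have off W z : general W -> p \in W -> q \in W -> z \in W -> z != p -> z != q ->
  gap z p q != 0 by move=> gW pW qW zW zp zq; apply: gW.
have inj := can_eq (reflect_atK p n).
have F1 x y z : x \in X -> y \in X -> z \in Y -> reflect_at p n z != x -> reflect_at p n z != y ->
    x != y -> gap (reflect_at p n z) x y != 0.
  move=> xX yX zY zx zy xy.
  have [zp|zp] := eqVneq z p; first by move: zx zy; rewrite zp sp => *; apply: gX.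
  have [zq|zq] := eqVneq z q; first by move: zx zy; rewrite zq sq => *; apply: gX.
  by apply: nT; apply: inT; rewrite ?mem_cat ?xX ?yX ?zY ?orbT //; apply: (off Y).
have F2 x y z : x \in Y -> y \in Y -> z \in X -> z != reflect_at p n x -> z != reflect_at p n y ->
    x != y -> gap z (reflect_at p n x) (reflect_at p n y) != 0.
  move=> xY yY zX zx zy xy.
  (* The reflection is an involutive isometry, so it can be moved from the two points to the
     third. *)
  have -> : gap z (reflect_at p n x) (reflect_at p n y) = gap (reflect_at p n z) x y.
    by rewrite -[in LHS](reflect_atK p n z) /gap !reflect_at_sqd.
  have zx' : reflect_at p n z != x by rewrite -inj reflect_atK.
  have zy' : reflect_at p n z != y by rewrite -inj reflect_atK.
  have [zp|zp] := eqVneq z p.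
    by move: zx' zy'; rewrite zp sp => *; exact: gY.
  have [zq|zq] := eqVneq z q.
    by move: zx' zy'; rewrite zq sq => *; exact: gY.
  by apply: nT; apply: inT; rewrite ?mem_cat ?xY ?yY ?zX ?orbT //; apply: (off X).
move=> x y z; rewrite !mem_cat.
case/orP=> [xX|/mapP[x0 xY ->]]; case/orP=> [yX|/mapP[y0 yY ->]];
  case/orP=> [zX|/mapP[z0 zY ->]] xy xz yz.
- exact: gX.
- by rewrite gapCr gapCl; apply: F1; rewrite // eq_sym.
- by rewrite gapCl; apply: F1; rewrite // eq_sym.
- by apply: F2; rewrite // -inj.
- exact: F1.
- by rewrite gapCl; apply: F2 => //; [rewrite eq_sym|rewrite -inj].
- by rewrite gapCr gapCl; apply: F2 => //; [rewrite eq_sym|rewrite eq_sym|rewrite -inj].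
- by move: xy xz yz; rewrite !inj /gap !reflect_at_sqd; apply: gY.
Qed.

Lemma glue p q u v X Y : p != q -> sqd u v = sqd p q ->
  general X -> general Y -> p \in X -> q \in X -> u \in Y -> v \in Y ->
  exists g, [/\ forall x y, sqd (g x) (g y) = sqd x y, g u = p, g v = q
              & general (X ++ map g Y)].
Proof.
move=> pq uv gX gY pX qX uY vY.
(* Translate [u] to [p], then reflect [v - u] onto [q - p], a vector of the same length; a generic
   reflection fixing [p] and [q] follows. *)
pose m := (v - u) - (q - p); pose g0 x := reflect_at p m (x - u + p).
have iso0 x y : sqd (g0 x) (g0 y) = sqd x y.
  rewrite reflect_at_sqd /sqd opprD addrACA subrr addr0 opprD opprK.
  by rewrite addrACA addrC [- u + u]addrC subrr add0r.
have g0u : g0 u = p by rewrite /g0 subrr add0r reflect_at_center.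
have g0v : g0 v = q.
  by rewrite /g0 /reflect_at addrK refl_swap ?(addrC p) ?subrK //; move: uv; rewrite sqdC (sqdC p).
have [|||n [ne gen]] := @glue_aligned p q X (map g0 Y) pq gX _ pX qX.
- exact: general_map.
- by rewrite -g0u map_f.
- by rewrite -g0v map_f.
exists (reflect_at p n \o g0); split.
- by move=> x y /=; rewrite reflect_at_sqd.
- by rewrite /= g0u reflect_at_center.
- by rewrite /= g0v reflect_at_fix.
- by rewrite map_comp.
Qed.

Definition unit_on X phi := forall x y, x \in X -> y \in X ->
  sqd x y = 1 -> sqd (phi x) (phi y) = 1.

(** The predicate [Q] on squared distances covers rods as well as bipyramids, which may fold. The
    maps [phi] need not be injective or isometric: they only keep unit distances. *)
Definition gadget (s : R) (Q : R -> Prop) := exists X u v,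
  [/\ general X, u \in X, v \in X, sqd u v = s
    & forall phi, unit_on X phi -> Q (sqd (phi u) (phi v))].

Definition sqrod (s : R) := gadget s (eq^~ s).

Lemma attach_gadgets (Q : R -> R -> Prop) P (L : seq ('rV[R]_d * 'rV[R]_d)) :
  general P ->
  (forall p q, (p, q) \in L ->
     [/\ p \in P, q \in P, p != q & gadget (sqd p q) (Q (sqd p q))]) ->
  exists X, [/\ general X, {subset P <= X}
    & forall phi, unit_on X phi ->
        forall p q, (p, q) \in L -> Q (sqd p q) (sqd (phi p) (phi q))].
Proof.
move=> gP; elim: L => [|[p q] L IH] hL; first by exists P; split.
have [|X [gX PX QX]] := IH; first by move=> p' q' pqL; apply: hL; rewrite inE pqL orbT.
have [pP qP pq [Y [u [v [gY uY vY uv QY]]]]] := hL p q (mem_head _ _).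
have [g [iso gu gv gXY]] := glue pq uv gX gY (PX _ pP) (PX _ qP) uY vY.
exists (X ++ map g Y); split=> // [x /PX xX|phi uphi p' q'].
  by rewrite mem_cat xX.
rewrite inE => /orP[/eqP[-> ->]|].
  (* As [g] is an isometry, [phi \o g] keeps the unit distances of [Y]. *)
  rewrite -{2}gu -{2}gv; apply: (QY (phi \o g)) => x y xY yY xy /=.
  by apply: uphi; rewrite ?iso // mem_cat map_f ?orbT.
by apply: QX => x y xX yX; apply: uphi; rewrite mem_cat ?xX ?yX.
Qed.

End Gluing.

(** * Bipyramids over a simplex, and pairs of them *)

Section Bipyramid.

Variables (R : realType) (d : nat).
Implicit Types (u v w x y : 'rV[R]_d).

(** The matrix with rows [m i] is square, so a one-sided inverse is two-sided: orthogonality of the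
    rows gives that of the columns. *)
Lemma orthogonal_frame_norm (m : 'I_d -> 'rV[R]_d) (k : R) : k != 0 ->
  (forall i j, dot (m i) (m j) = k * (i == j)%:R) ->
  forall w, k * dot w w = \sum_i dot w (m i) ^+ 2.
Proof.
move=> k0 hm w; pose M : 'M[R]_d := \matrix_i m i.
have dotmx x y : (x *m y^T) ord0 ord0 = dot x y.
  by rewrite mxE; apply: eq_bigr => i _; rewrite mxE.
have MMT : M *m (k^-1 *: M^T) = 1%:M.
  rewrite -scalemxAr; apply/matrixP => i j; rewrite !mxE.
  transitivity (k^-1 * dot (m i) (m j)); last by rewrite hm mulKf.
  by congr (_ * _); apply: eq_bigr => l _; rewrite !mxE.
have MTM : M^T *m M = k%:M.
  move: (mulmx1C MMT); rewrite -scalemxAl => /(congr1 ( *:%R k)).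
  by rewrite scalerA mulfV // scale1r scale_scalar_mx mulr1.
transitivity ((w *m (M^T *m M) *m w^T) ord0 ord0).
  by rewrite MTM mul_mx_scalar -scalemxAl mxE dotmx.
rewrite mulmxA -mulmxA -[M *m w^T]trmxK trmx_mul trmxK dotmx.
apply: eq_bigr => i _; rewrite expr2.
have -> : (w *m M^T) ord0 i = dot w (m i).
  by rewrite mxE; apply: eq_bigr => l _; rewrite !mxE.
by [].
Qed.

(* The Gram matrix of the vectors [c i := b i - u] is [(B/2) I + (A - B/2) J], *)
(* [J] being the all-one matrix, so adding a suitable multiple of [\sum_i c i] *)
(* to each [c i] produces an orthogonal frame, which measures [v - u].         *)
Lemma bipyramid_apexes (A B D : R) (b : 'I_d -> 'rV[R]_d) u v : (0 < d)%N ->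
  0 < B -> 0 < D -> d%:R * D = 4 * d%:R * A - 2 * (d%:R - 1) * B ->
  (forall i j, i != j -> sqd (b i) (b j) = B) ->
  (forall i, sqd u (b i) = A) -> (forall i, sqd v (b i) = A) ->
  sqd u v = 0 \/ sqd u v = D.
Proof.
move=> d0 B0 D0 DE hb hu hv.
have [c cE] : exists c : 'I_d -> 'rV[R]_d, forall i, c i = b i - u.
  by exists (fun i => b i - u).
have [s sE] : exists s, s = \sum_i c i by exists (\sum_i c i).
pose g := A - B / 2.
have dR : 0 < d%:R :> R by rewrite ltr0n.
have cc i j : dot (c i) (c j) = g + (B / 2) * (i == j)%:R.
  have ci l : dot (c l) (c l) = A by rewrite cE -(hu l) sqdC.
  have [<-|ij] := eqVneq i j; first by rewrite ci /g mulr1 subrK.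
  have : sqd (b i) (b j) = dot (c i) (c i) + dot (c j) (c j) - 2 * dot (c i) (c j).
    rewrite /sqd (_ : b i - b j = c i - c j); last by rewrite !cE opprB addrA subrK.
    by move: (c i) (c j) => x y; rewrite !dotE (dotC y x); ring.
  by rewrite hb // !ci mulr0 /g => h; lra.
have dot_suml x : dot s x = \sum_i dot (c i) x.
  rewrite sE; apply: (big_morph (fun y => dot y x)) => [y z|]; last exact: dot0l.
  exact: dotDl.
pose sg := B / 2 + d%:R * g.
have sgE : 4 * sg = d%:R * D by rewrite DE /sg /g; field.
have sg0 : 0 < sg by rewrite -(pmulr_rgt0 _ (ltr0n R 4)) sgE mulr_gt0.
have sc i : dot s (c i) = sg.
  rewrite dot_suml (eq_bigr (fun j => g + (B / 2) * (j == i)%:R)) //.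
  rewrite big_split /= sumr_const card_ord -mulr_sumr (bigD1 i) //= eqxx big1.
    by rewrite addr0 mulr1 -[g *+ d]mulr_natl addrC.
  by move=> j /negPf ->.
have ss : dot s s = d%:R * sg.
  rewrite dot_suml (eq_bigr (fun=> sg)) ?sumr_const ?card_ord ?mulr_natl //.
  by move=> i _; rewrite dotC sc.
(* The Gram matrix has eigenvalue [sg] on the all-one vector and [B / 2] on its orthogonal
   complement. Adding [mu *: s] to each [c i] multiplies their sum by [t], which turns [sg] into
   [t ^+ 2 * sg = B / 2]. *)
pose t := Num.sqrt (B / 2 / sg).
have t2 : t ^+ 2 = B / 2 / sg by rewrite sqr_sqrtr // !divr_ge0 // ltW.
pose mu := (t - 1) / d%:R.
have frame i j : dot (c i + mu *: s) (c j + mu *: s) = (B / 2) * (i == j)%:R.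
  rewrite dotDl !dotDr !dotZl !dotZr ss (dotC (c i) s) !sc cc.
  have -> : sg = B / 2 / t ^+ 2.
    by rewrite t2; field; rewrite !gt_eqF.
  have -> : g = (sg - B / 2) / d%:R by rewrite /sg; field; rewrite gt_eqF.
  have -> : sg = B / 2 / t ^+ 2.
    by rewrite t2; field; rewrite !gt_eqF.
  have t0 : t != 0 by rewrite -sqrf_eq0 t2 gt_eqF // !divr_gt0.
  by rewrite /mu; field; rewrite t0 gt_eqF.
have B20 : B / 2 != 0 by rewrite gt_eqF // divr_gt0.
have := orthogonal_frame_norm B20 frame (v - u).
have wc i : dot (v - u) (c i) = sqd u v / 2.
  have : sqd v (b i) = dot (v - u) (v - u) + dot (c i) (c i) - 2 * dot (v - u) (c i).
    rewrite /sqd (_ : v - b i = (v - u) - c i); last by rewrite !cE opprB addrA subrK.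
    by move: (v - u) (c i) => x y; rewrite !dotE (dotC y x); ring.
  have -> : dot (c i) (c i) = A by rewrite cE -(hu i) sqdC.
  by rewrite hv (sqdC u) /sqd; move: (dot _ _) (dot _ _) => x y h; lra.
have ws : dot (v - u) s = d%:R * (sqd u v / 2).
  rewrite dotC dot_suml (eq_bigr (fun=> sqd u v / 2)) => [|i _]; last by rewrite dotC wc.
  by rewrite sumr_const card_ord mulr_natl.
rewrite -/(sqd v u) sqdC.
rewrite (eq_bigr (fun=> (t * (sqd u v / 2)) ^+ 2)) => [|i _]; last first.
  by rewrite dotDr dotZr wc ws /mu; congr (_ ^+ 2); field; rewrite gt_eqF.
rewrite sumr_const card_ord -[_ *+ d]mulr_natl exprMn t2; move: (sqd u v) => o h.
(* With [o = sqd u v], the frame identity is quadratic in [o], with roots 0 and [4 * sg / d = D]. *)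
have {}h : o * (4 * sg - d%:R * o) = 0.
  have -> : o * (4 * sg - d%:R * o) = (8 * sg / B) * (B / 2 * o
      - d%:R * (B / 2 / sg * (o / 2) ^+ 2)).
    by field; rewrite !gt_eqF.
  by rewrite h subrr mulr0.
move/eqP: h; rewrite sgE -mulrBr !mulf_eq0 (gt_eqF dR) /= subr_eq0.
by move=> /orP[/eqP|/eqP]; [left|right].
Qed.

Lemma dot_delta (i j : 'I_d) :
  dot (delta_mx ord0 i : 'rV[R]_d) (delta_mx ord0 j) = (i == j)%:R.
Proof.
rewrite /dot (bigD1 i) //= !mxE !eqxx mul1r big1 ?addr0 // => l li.
by rewrite !mxE (negPf li) mul0r.
Qed.

Lemma dot_delta_const (i : 'I_d) (l : R) :
  dot (delta_mx ord0 i : 'rV[R]_d) (const_mx l) = l.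
Proof.
rewrite /dot (bigD1 i) //= !mxE !eqxx mul1r big1 ?addr0 // => k ki.
by rewrite !mxE (negPf ki) mul0r.
Qed.

Lemma dot_const (k l : R) : dot (const_mx k : 'rV[R]_d) (const_mx l) = d%:R * (k * l).
Proof.
rewrite /dot (eq_bigr (fun=> k * l)) ?sumr_const ?card_ord ?mulr_natl // => i _.
by rewrite !mxE.
Qed.

Hypothesis d3 : (2 < d)%N.

Lemma bipyramid_gadget (A B D : R) : 0 < B -> 0 < D ->
  d%:R * D = 4 * d%:R * A - 2 * (d%:R - 1) * B ->
  sqrod d A -> sqrod d B -> gadget d D (fun r => r = 0 \/ r = D).
Proof.
move=> B0 D0 DE rA rB.
have dR : 2 < d%:R :> R by rewrite ltr_nat.
have dR0 : d%:R != 0 :> R by rewrite pnatr_eq0 -lt0n (ltn_trans _ d3).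
pose be := Num.sqrt (B / 2); pose t := Num.sqrt (D / (4 * d%:R)).
have be2 : be ^+ 2 = B / 2 by rewrite sqr_sqrtr // divr_ge0 // ltW.
have t2 : t ^+ 2 = D / (4 * d%:R) by rewrite sqr_sqrtr // divr_ge0 ?mulr_ge0 // ltW.
have AE : A = D / 4 + (d%:R - 1) * B / (2 * d%:R).
  have -> : D = (4 * d%:R * A - 2 * (d%:R - 1) * B) / d%:R by rewrite -DE; field.
  by field.
(* The base consists of scaled coordinate vectors; the apexes lie on the diagonal, symmetric about
   the centroid, at squared distance [4 * d * t ^+ 2 = D]. *)
pose b i : 'rV[R]_d := be *: delta_mx ord0 i.
pose u : 'rV[R]_d := const_mx (be / d%:R + t).
pose v : 'rV[R]_d := const_mx (be / d%:R - t).
have bb i j : i != j -> sqd (b i) (b j) = B.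
  move=> ij; rewrite /sqd /b !dotE !dot_delta !eqxx (negPf ij) eq_sym (negPf ij) /=.
  transitivity (2 * be ^+ 2); [by ring|by rewrite be2; field].
have ub i : sqd u (b i) = A.
  rewrite /sqd /b /u !dotE !dot_delta !(dotC (const_mx _)) !dot_delta_const dot_const eqxx /=.
  transitivity (d%:R * t ^+ 2 + be ^+ 2 * (1 - d%:R^-1)); first by field.
  by rewrite t2 be2 AE; field.
have vb i : sqd v (b i) = A.
  rewrite /sqd /b /v !dotE !dot_delta !(dotC (const_mx _)) !dot_delta_const dot_const eqxx /=.
  transitivity (d%:R * t ^+ 2 + be ^+ 2 * (1 - d%:R^-1)); first by field.
  by rewrite t2 be2 AE; field.
have uv : sqd u v = D.
  rewrite /sqd /u /v !dotE !dot_const.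
  by transitivity (4 * d%:R * t ^+ 2); [ring|rewrite t2; field].
have bu i : sqd (b i) u = A by rewrite sqdC.
have bv i : sqd (b i) v = A by rewrite sqdC.
have vu : sqd v u = D by rewrite sqdC.
pose P := [:: u, v & [seq b i | i <- enum 'I_d]].
have bP i : b i \in P by rewrite !inE map_f ?orbT // mem_enum.
(* The triangles have squared sides [B, B, B], or [A, A, B], or [A, A, D]; their gaps are the
   numbers in [K1], [K2], [K3]. *)
have cB : 0 < 4 * A - B.
  rewrite (_ : 4 * A - B = D + B * (d%:R - 2) / d%:R); last by rewrite AE; field.
  by rewrite addr_gt0 // divr_gt0 ?mulr_gt0 ?subr_gt0 //; lra.
have cD : 0 < 4 * A - D.
  rewrite (_ : 4 * A - D = 2 * B * (d%:R - 1) / d%:R); last by rewrite AE; field.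
  by rewrite divr_gt0 ?mulr_gt0 ?subr_gt0 //; lra.
have A0 : 0 < A by lra.
have K1 : 3 * B ^+ 2 != 0 by rewrite gt_eqF // mulr_gt0 // exprn_gt0.
have K2 : B * (4 * A - B) != 0 by rewrite gt_eqF // mulr_gt0.
have K3 : D * (4 * A - D) != 0 by rewrite gt_eqF // mulr_gt0.
have gP : general P.
  have inP x : x \in P -> [\/ x = u, x = v | exists i, x = b i].
    rewrite !inE => /or3P[/eqP|/eqP|/mapP[i _]];
      [constructor 1|constructor 2|constructor 3; exists i] => //.
  move=> x y z /inP[->|->|[i ->]] /inP[->|->|[j ->]] /inP[->|->|[k ->]];
    rewrite ?eqxx // => h1 h2 h3; rewrite /gap ?uv ?vu ?ub ?vb ?bu ?bv ?bb //;
    try (by apply: contraNneq h1 => ->); try (by apply: contraNneq h2 => ->);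
    try (by apply: contraNneq h3 => ->);
    first [ by rewrite (_ : _ - _ = 3 * B ^+ 2); [|ring]
          | by rewrite (_ : _ - _ = B * (4 * A - B)); [|ring]
          | by rewrite (_ : _ - _ = D * (4 * A - D)); [|ring] ].
pose L := [seq e <- [seq (x, y) | x <- P, y <- P]
          | (e.1 != e.2) && ((sqd e.1 e.2 == A) || (sqd e.1 e.2 == B))].
have [|X [gX PX hX]] := @attach_gadgets _ _ d3 (fun s r => r = s) P L gP.
  move=> x y; rewrite mem_filter => /andP[/andP[xy h]].
  move=> /allpairsP[[x' y'] [xP yP [ex ey]]]; rewrite /= ex ey in xy h xP yP *.
  by split=> //; case/orP: h => /eqP ->.
have inL x y : x \in P -> y \in P -> sqd x y = A \/ sqd x y = B -> (x, y) \in L.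
  move=> xP yP h; rewrite mem_filter allpairs_f // andbT -sqd_eq0 /=.
  by case: h => ->; rewrite eqxx ?orbT andbT gt_eqF.
have uP : u \in P by rewrite !inE eqxx.
have vP : v \in P by rewrite !inE eqxx orbT.
exists X, u, v; split=> //; [exact: PX|exact: PX|move=> phi /hX hphi].
apply: (@bipyramid_apexes A B D (phi \o b)) => //=.
- exact: ltn_trans d3.
- by move=> i j ij; rewrite hphi ?bb //; apply: inL => //; right; apply: bb.
- by move=> i; rewrite hphi ?ub //; apply: inL => //; left.
- by move=> i; rewrite hphi ?vb //; apply: inL => //; left.
Qed.

(* A folded bipyramid would collapse the triangle [u v v'] to a segment of     *)
(* squared length [0] or [D], which [r] is not.                                *)
Lemma spindle_sqrod (D r : R) : 0 < r -> r < 4 * D -> r != D ->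
  sqrod d r -> gadget d D (fun s => s = 0 \/ s = D) -> sqrod d D.
Proof.
move=> r0 rD nrD rr gD.
have D0 : 0 < D by lra.
pose i0 : 'I_d := Ordinal (ltn_trans (isT : 0 < 2)%N d3).
pose i1 : 'I_d := Ordinal (ltn_trans (isT : 1 < 2)%N d3).
(* The common apex is 0; [v] and [v'] complete an isosceles triangle with squared legs [D] and
   squared base [r], which exists as [r < 4 * D]. *)
pose x := Num.sqrt r / 2; pose y := Num.sqrt (D - r / 4).
have x2 : x ^+ 2 = r / 4.
  by rewrite /x exprMn sqr_sqrtr ?ltW // exprVn -natrX.
have y2 : y ^+ 2 = D - r / 4 by rewrite sqr_sqrtr //; lra.
pose v : 'rV[R]_d := x *: delta_mx ord0 i0 + y *: delta_mx ord0 i1.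
pose v' : 'rV[R]_d := - x *: delta_mx ord0 i0 + y *: delta_mx ord0 i1.
have uv : sqd 0 v = D.
  rewrite sqdC /sqd subr0 /v !dotE !dot_delta !eqxx
    (_ : i1 == i0 = false) // (_ : i0 == i1 = false) //=.
  by transitivity (x ^+ 2 + y ^+ 2); [ring|rewrite x2 y2; field].
have uv' : sqd 0 v' = D.
  rewrite sqdC /sqd subr0 /v' !dotE !dot_delta !eqxx
    (_ : i1 == i0 = false) // (_ : i0 == i1 = false) //=.
  by transitivity (x ^+ 2 + y ^+ 2); [ring|rewrite x2 y2; field].
have vv' : sqd v v' = r.
  rewrite /sqd /v /v' !dotE !dot_delta !eqxx
    (_ : i1 == i0 = false) // (_ : i0 == i1 = false) //=.
  by transitivity (4 * x ^+ 2); [ring|rewrite x2; field].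
move: v v' uv uv' vv' => v v' uv uv' vv'.
have K : r * (4 * D - r) != 0 by rewrite gt_eqF // mulr_gt0 // subr_gt0.
pose P := [:: 0; v; v'].
have gP : general P.
  have [vu v'u v'v] : [/\ sqd v 0 = D, sqd v' 0 = D & sqd v' v = r].
    by rewrite sqdC uv sqdC uv' sqdC vv'.
  move=> a b c; rewrite !inE => /or3P[]/eqP-> /or3P[]/eqP-> /or3P[]/eqP->;
    rewrite ?eqxx // => _ _ _; rewrite /gap ?uv ?uv' ?vv' ?vu ?v'u ?v'v;
    by rewrite (_ : _ - _ = r * (4 * D - r)); [|ring].
have [nuv nuv' nvv'] : [/\ 0 != v, 0 != v' & v != v'].
  by rewrite -!sqd_eq0 uv uv' vv' !gt_eqF.
(* One predicate serves all three pairs: folding is allowed only at [s = D], hence not for the pair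
   held at [r]. *)
pose Q (s q : R) := q = s \/ s = D /\ q = 0.
have [|X [gX PX hX]] := @attach_gadgets _ _ d3 Q P [:: (0, v); (0, v'); (v, v')] gP.
  have gDQ : gadget d D (Q D).
    have [X [a [b [? ? ? ? h]]]] := gD; exists X, a, b; split=> // phi /h[->|->].
      by right.
    by left.
  have grQ : gadget d r (Q r).
    by have [X [a [b [? ? ? ? h]]]] := rr; exists X, a, b; split=> // phi /h ->; left.
  move=> p q; rewrite !inE => /or3P[]/eqP[-> ->]; rewrite ?uv ?uv' ?vv';
    by split; rewrite // ?eqxx ?orbT.
exists X, 0, v; split=> //; [by apply: PX; rewrite !inE eqxx ?orbT..|].
move=> phi /hX h.
have := h v v'; rewrite !inE eqxx !orbT vv' => /(_ isT) [hr|[/eqP]]; last first.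
  by rewrite (negPf nrD).
have := h 0 v; rewrite !inE eqxx uv => /(_ isT) [//|[_ /eqP]].
rewrite sqd_eq0 => /eqP h0; move: hr; rewrite -h0 => hr.
have := h 0 v'; rewrite !inE eqxx !orbT uv' hr => /(_ isT) [/eqP|[_ /eqP]].
  by rewrite (negPf nrD).
by rewrite gt_eqF.
Qed.

End Bipyramid.

(** * Density of multiplicative semigroups of positive reals *)

Section MultiplicativeDensity.

Variable R : realType.
Implicit Types (a b e h x : R).

Lemma expr_unbounded x a : 1 < x -> exists n, a < x ^+ n.
Proof.
move=> x1; have bern n : 1 + n%:R * (x - 1) <= x ^+ n.
  elim: n => [|n IH]; first by rewrite mul0r addr0 expr0.
  have : x * (1 + n%:R * (x - 1)) <= x ^+ n.+1.
    by rewrite exprS ler_pM2l // (lt_trans ltr01).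
  have : 0 <= n%:R * (x - 1) * (x - 1) by rewrite !mulr_ge0 ?ler0n ?subr_ge0 ?ltW.
  by rewrite -natr1; lra.
have x0 : 0 < x - 1 by rewrite subr_gt0.
have /archi_boundP : 0 <= `|a| / (x - 1) by rewrite divr_ge0 // ltW.
move: (Num.bound _) => N; rewrite ltr_pdivrMr // => aN.
by exists N; have := bern N; have := ler_norm a; lra.
Qed.

(** The first term of the progression beyond [a] is at most [h] times a term that is not. *)
Lemma geometric_hits e h a b : 0 < e -> e <= a -> 1 < h -> h * a < b ->
  exists n, a < e * h ^+ n < b.
Proof.
move=> e0 ea h1 hab; have exn : exists n, a < e * h ^+ n.
  have [n hn] := expr_unbounded (a / e) h1.
  by exists n; rewrite mulrC -ltr_pdivrMr.
case: (ex_minnP exn) => -[|n] an nmin; first by move: an; rewrite expr0 mulr1 ltNge ea.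
exists n.+1; rewrite an; apply: le_lt_trans hab.
rewrite exprS mulrCA ler_pM2l ?(lt_trans ltr01) // leNgt.
by apply/negP => /nmin; rewrite ltnn.
Qed.

(* If [s := inf H_(>1)] and [t := sup H_(<1)] were both different from [1],    *)
(* multiplying elements of [H] close to [s] and to [t] would give an element   *)
(* strictly between [t] and [s], hence [1].                                    *)
Lemma mult_near1 (H : R -> Prop) (c : R) :
  (forall h, H h -> 0 < h) -> (forall h, H h -> h != 1) ->
  (forall g h, H g -> H h -> H (g * h)) ->
  (exists2 h, H h & h < 1) -> (exists2 h, H h & 1 < h) -> 1 < c ->
  exists2 h, H h & c^-1 < h < c.
Proof.
move=> Hp Hn1 HM [e He e1] [m Hm m1] c1; apply: contrapT => noH.
have c0 : 0 < c := lt_trans ltr01 c1.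
pose U h := H h /\ 1 < h; pose L h := H h /\ h < 1.
have lbU : lbound U c.
  move=> h [Hh h1]; rewrite leNgt; apply/negP => hc; apply: noH; exists h => //.
  by rewrite hc andbT (lt_trans _ h1) // invf_lt1.
have ubL : ubound L c^-1.
  move=> h [Hh h1]; rewrite leNgt; apply/negP => hc; apply: noH; exists h => //.
  by rewrite hc (lt_trans h1).
have Um : U m by []. have Le : L e by [].
have infU : has_inf U by split; [exists m|exists c].
have supL : has_sup L by split; [exists e|exists c^-1].
have cs : c <= inf U by apply: lb_le_inf => //; exists m.
have tc : sup L <= c^-1 by apply: ge_sup => //; exists e.
have et : e <= sup L by apply: ub_le_sup => //; exists c^-1.
move: (inf U) (sup L) cs tc et 
  (fun x px => @inf_adherent _ U x px infU) (fun x px => @sup_adherent _ L x px supL)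
  (ge_inf infU.2) (ub_le_sup supL.2) => s t cs tc et adhs adht ges let_.
have t0 : 0 < t := lt_le_trans (Hp _ He) et.
have t1 : t < 1 by rewrite (le_lt_trans tc) // invf_lt1.
have s1 : 1 < s := lt_le_trans c1 cs.
have s0 : 0 < s := lt_trans ltr01 s1.
(* Together with [s <= p] and [q <= t], the bounds [p < s / t] and [t / s < q] give
   [t < p * q < s]. *)
have [p [Hp' p1] ps] : exists2 p, U p & p < s / t.
  have [|p Up ps] := adhs (s / t - s); last by exists p; rewrite // subrKC in ps.
  by rewrite subr_gt0 ltr_pdivlMr // gtr_pMr.
have [q [Hq q1] qt] : exists2 q, L q & t / s < q.
  have [|q Lq qt] := adht (t - t / s); last by exists q; rewrite // subKr in qt.
  by rewrite subr_gt0 ltr_pdivrMr // ltr_pMr.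
have p0 := Hp _ Hp'; have q0 := Hp _ Hq; have Hpq := HM _ _ Hp' Hq.
have := Hn1 _ Hpq; rewrite neq_lt => /orP[pq|pq].
  have := let_ _ (conj Hpq pq); apply/negP; rewrite -ltNge.
  apply: lt_le_trans (ler_wpM2r (ltW q0) (ges _ (conj Hp' p1))).
  by rewrite mulrC -ltr_pdivrMr.
have := ges _ (conj Hpq pq); apply/negP; rewrite -ltNge.
apply: le_lt_trans (ler_wpM2l (ltW p0) (let_ _ (conj Hq q1))) _.
by rewrite -ltr_pdivlMr.
Qed.

(** Some [h] in [H] is so close to 1 that its powers cannot jump over the interval. If [h < 1],
    descend from an element of [H] beyond [b]; if [h > 1], climb from one below [a]. *)
Lemma mult_dense (H : R -> Prop) a b :
  (forall h, H h -> 0 < h) -> (forall h, H h -> h != 1) ->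
  (forall g h, H g -> H h -> H (g * h)) ->
  (exists2 h, H h & h < 1) -> (exists2 h, H h & 1 < h) -> 0 < a -> a < b ->
  exists2 h, H h & a < h < b.
Proof.
move=> Hp Hn1 HM ltH gtH a0 ab; have b0 := lt_trans a0 ab.
have c1 : 1 < b / a by rewrite ltr_pdivlMr // mul1r.
have [h Hh /andP[ch hc]] := mult_near1 Hp Hn1 HM ltH gtH c1.
have HX g n : H g -> H (g ^+ n.+1).
  by move=> Hg; elim: n => // n IH; rewrite exprS; apply: HM.
have HMX g n : H g -> H (g * h ^+ n).
  by move=> Hg; case: n => [|n]; rewrite ?mulr1 //; apply/HM/HX.
have h0 := Hp _ Hh.
have := Hn1 _ Hh; rewrite neq_lt => /orP[h1|h1].
  have [m Hm m1] := gtH; have m0 := Hp _ Hm.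
  have [n bn] := expr_unbounded b m1.
  have mb : b <= m ^+ n.+1 by rewrite exprS (le_trans (ltW bn)) // ler_peMl ?exprn_ge0 ?ltW.
  have mn0 : 0 < m ^+ n.+1 by rewrite exprn_gt0.
  (* Taking inverses turns the descending progression into an ascending one. *)
  have [||||k /andP[k1 k2]] := @geometric_hits (m ^+ n.+1)^-1 h^-1 b^-1 a^-1.
  - by rewrite invr_gt0.
  - by rewrite lef_pV2.
  - by rewrite invf_gt1.
  - by rewrite -invfM ltf_pV2 ?posrE ?mulr_gt0 // -ltr_pdivrMr // -invf_div.
  exists (m ^+ n.+1 * h ^+ k); first exact/HMX/HX.
  have hk0 : 0 < h ^+ k by rewrite exprn_gt0.
  move: k1 k2; rewrite exprVn -invfM !ltf_pV2 ?posrE ?mulr_gt0 //.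
  by move=> -> ->.
have [e He e1] := ltH; have e0 := Hp _ He.
have [|n an] := @expr_unbounded e^-1 a^-1; first by rewrite invf_gt1.
have ea : e ^+ n.+1 <= a.
  rewrite exprS (@le_trans _ _ (e ^+ n)) // ?ler_piMl ?exprn_ge0 ?ltW //.
  by move: an; rewrite exprVn ltf_pV2 ?posrE ?exprn_gt0.
have [|//|//||k kab] := @geometric_hits (e ^+ n.+1) h a b.
- by rewrite exprn_gt0.
- by rewrite -ltr_pdivlMr.
- by exists (e ^+ n.+1 * h ^+ k) => //; exact/HMX/HX.
Qed.

End MultiplicativeDensity.

(** * The rod lengths obtained, and their density *)

Section Rods.

Variables (R : realType) (d : nat).
Hypothesis d3 : (2 < d)%N.

Lemma sqrod1 : sqrod d (1 : R).
Proof.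
pose i0 : 'I_d := Ordinal (ltn_trans (isT : 0 < 2)%N d3).
pose e : 'rV[R]_d := delta_mx ord0 i0.
have e1 : sqd e 0 = 1 by rewrite /sqd subr0 dot_delta eqxx.
exists [:: e; 0], e, 0; split; rewrite ?inE ?eqxx ?orbT //.
  move=> x y z; rewrite !inE => /orP[]/eqP-> /orP[]/eqP-> /orP[]/eqP->;
  by rewrite ?eqxx.
by move=> phi uphi; apply: uphi; rewrite ?inE ?eqxx ?orbT.
Qed.

Lemma sqrod_spindle (A B D r : R) : 0 < B -> 0 < D ->
  d%:R * D = 4 * d%:R * A - 2 * (d%:R - 1) * B ->
  0 < r -> r < 4 * D -> r != D ->
  sqrod d A -> sqrod d B -> sqrod d r -> sqrod d D.
Proof.
move=> B0 D0 DE r0 rD nrD rA rB rr; apply: (spindle_sqrod d3 r0) => //.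
exact: bipyramid_gadget rA rB.
Qed.

Lemma dim_ge3 : 3 <= d%:R :> R.
Proof. by rewrite ler_nat. Qed.

Lemma dim_neq0 : d%:R != 0 :> R.
Proof. by rewrite gt_eqF // (lt_le_trans _ dim_ge3). Qed.

Definition stretch : R := 2 * (d%:R + 1) / d%:R.

Lemma stretch_bounds : 2 < stretch < 4.
Proof.
have d3R := dim_ge3; have d0 : 0 < d%:R :> R by lra.
by rewrite ltr_pdivlMr // ltr_pdivrMr //; apply/andP; split; lra.
Qed.

Lemma sqrod_stretch (s : R) : 0 < s -> sqrod d s -> sqrod d (stretch * s).
Proof.
move=> s0 rs; have /andP[m2 m4] := stretch_bounds.
have ms : 2 * s < stretch * s by rewrite ltr_pM2r.
apply: (@sqrod_spindle s s _ s) => //; try lra.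
by rewrite /stretch; field; exact: dim_neq0.
Qed.

Lemma sqrod_stretchX (k : nat) (s : R) : 0 < s -> sqrod d s ->
  sqrod d (stretch ^+ k * s).
Proof.
have /andP[m2 _] := stretch_bounds.
move=> s0 rs; elim: k => [|k IH]; first by rewrite expr0 mul1r.
rewrite exprS -mulrA; apply: sqrod_stretch => //.
by rewrite mulr_gt0 ?exprn_gt0 //; lra.
Qed.

(** With the spindle base [r = s], the lower bound says [r < 4 * D] and the upper one gives [D < r],
    so [r != D]. *)
Lemma sqrod_shrink (k : nat) (s : R) : 1 / 4 < 4 * stretch ^+ k / d%:R ^+ 2 < 1 ->
  0 < s -> sqrod d s -> sqrod d (4 * stretch ^+ k / d%:R ^+ 2 * s).
Proof.
move=> /andP[k1 k2] s0 rs; have /andP[m2 _] := stretch_bounds.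
have mk0 j : 0 < stretch ^+ j by rewrite exprn_gt0; lra.
set e := 4 * _ / _ in k1 k2 *.
have es1 : s * (1 / 4) < s * e by rewrite ltr_pM2l.
have es2 : s * e < s * 1 by rewrite ltr_pM2l.
rewrite mulrC; apply: (@sqrod_spindle (stretch ^+ k * s) (stretch ^+ k.+1 * s) _ s) => //; try lra.
- by rewrite mulr_gt0.
- rewrite /e [stretch ^+ k.+1]exprS; move: (stretch ^+ k) => M.
  by rewrite /stretch; field; exact: dim_neq0.
- exact: sqrod_stretchX.
- exact: sqrod_stretchX.
Qed.

(** For the least [k] with value above [1 / 4], the value is below 1 because [stretch < 4]; at
    [k = 0] it is at most [4 / 9]. *)
Lemma exists_shrink : exists k, 1 / 4 < 4 * stretch ^+ k / d%:R ^+ 2 < 1.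
Proof.
have /andP[m2 m4] := stretch_bounds.
have d20 : 0 < d%:R ^+ 2 :> R by rewrite exprn_gt0 //; have := dim_ge3; lra.
have exk : exists k, 1 / 4 < 4 * stretch ^+ k / d%:R ^+ 2.
  have [|k hk] := @expr_unbounded _ stretch (d%:R ^+ 2); first lra.
  by exists k; rewrite ltr_pdivlMr //; lra.
case: (ex_minnP exk) => k hk kmin; exists k; rewrite hk /= ltr_pdivrMr // mul1r.
case: k hk kmin => [|k] hk kmin.
  rewrite expr0; have : 3 * 3 <= d%:R * d%:R :> R by apply: ler_pM => //; exact: dim_ge3.
  by rewrite expr2; lra.
have : ~~ (1 / 4 < 4 * stretch ^+ k / d%:R ^+ 2) by apply/negP => /kmin; rewrite ltnn.
rewrite -leNgt ler_pdivrMr // [stretch ^+ k.+1]exprS => h.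
have : stretch * (4 * stretch ^+ k) <= stretch * (1 / 4 * d%:R ^+ 2).
  by rewrite ler_pM2l //; lra.
have : stretch * (1 / 4 * d%:R ^+ 2) < 4 * (1 / 4 * d%:R ^+ 2).
  by rewrite ltr_pM2r //; lra.
lra.
Qed.

(* [d + 1] would divide a power of [d]. *)
Lemma stretch_shrink_independent (k i j : nat) : (0 < i + j)%N ->
  (4 * stretch ^+ k / d%:R ^+ 2) ^+ i * stretch ^+ j != 1.
Proof.
move=> ij; apply/eqP => h; have [N NE] : exists N, N = (k * i + j)%N by exists (k * i + j)%N.
have : (4 ^ i * (2 ^ N * d.+1 ^ N) = d ^ (2 * i + N))%N.
  apply/eqP; rewrite -(eqr_nat R) !natrM !natrX.
  have -> : 2 ^+ N * d.+1%:R ^+ N = stretch ^+ N * d%:R ^+ N :> R.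
    by rewrite -!exprMn /stretch -[d.+1%:R]natr1; congr (_ ^+ N); field; exact: dim_neq0.
  apply/eqP; transitivity ((4 * stretch ^+ k / d%:R ^+ 2) ^+ i * stretch ^+ j
      * d%:R ^+ (2 * i + N)); last by rewrite h mul1r.
  move: stretch {h} (expf_neq0 (2 * i)%N dim_neq0) => s dX.
  rewrite !exprMn exprVn -!exprM [d%:R ^+ (_ + _)]exprD.
  by rewrite [in s ^+ N]NE [s ^+ _]exprD; field.
(* If [N = 0] then [j = 0], and the equation reads [4 ^ i = d ^ (2 * i)] with [i > 0], forcing
   [d = 2]. *)
have [N0|N0] := posnP N.
  have /eqP := N0; rewrite NE addn_eq0 -NE => /andP[_ /eqP j0].
  have i0 : (0 < i)%N by rewrite j0 addn0 in ij.
  rewrite N0 !expn0 !muln1 addn0 expnM => /eqP.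
  by rewrite eqn_exp2r // -[4%N]/(2 ^ 2)%N eqn_exp2r // => /eqP d2; move: d3; rewrite -d2.
move=> e; have dv : (d.+1 %| d ^ (2 * i + N))%N.
  by rewrite -e mulnA dvdn_mull // -(prednK N0) expnS dvdn_mulr.
have /eqP : coprime d.+1 (d ^ (2 * i + N)) by rewrite coprimeXr // coprimeSn.
move/gcdn_idPl: dv => -> /eqP; rewrite eqSS => /eqP d0.
by move: d3; rewrite d0.
Qed.

Lemma sqrod_dense (a b : R) : 0 < a -> a < b ->
  exists2 s, a < s < b & sqrod d s.
Proof.
move=> a0 ab; have [k kb] := exists_shrink; have /andP[k1 k2] := kb.
have /andP[m2 m4] := stretch_bounds.
set e := 4 * _ / _ in k1 k2.
pose H h := exists i j, (0 < i + j)%N /\ h = e ^+ i * stretch ^+ j.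
have [|||||h [i [j [_ ->]]] hab] := @mult_dense R H a b _ _ _ _ _ a0 ab.
- by move=> _ [i [j [_ ->]]]; rewrite mulr_gt0 // exprn_gt0 //; lra.
- by move=> _ [i [j [ij ->]]]; exact: stretch_shrink_independent.
- move=> _ _ [i [j [ij ->]]] [i' [j' [ij' ->]]]; exists (i + i')%N, (j + j')%N.
  by rewrite addnACA addn_gt0 ij; split=> //; rewrite !exprD mulrACA.
- by exists e => //; exists 1%N, 0%N; rewrite expr1 expr0 mulr1.
- by exists stretch; [exists 0%N, 1%N; rewrite expr1 expr0 mul1r|lra].
exists (e ^+ i * stretch ^+ j) => //.
have rj : sqrod d (stretch ^+ j).
  by rewrite -[_ ^+ j]mulr1; apply: sqrod_stretchX => //; exact: sqrod1.
elim: i {hab} => [|i IH]; first by rewrite expr0 mul1r.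
rewrite exprS -mulrA; apply: sqrod_shrink => //.
by rewrite mulr_gt0 // exprn_gt0 //; lra.
Qed.

(** * From point sets to unit distance graphs *)

Section UnitGraph.

Variable X : seq 'rV[R]_d.

Definition unit_adj (x y : seq_sub X) := sqd (val x) (val y) == 1.

Lemma unit_adj_sym : symmetric unit_adj.
Proof. by move=> x y; rewrite /unit_adj sqdC. Qed.

Lemma unit_adj_irr : irreflexive unit_adj.
Proof. by move=> x; rewrite /unit_adj /sqd subrr dot0l eq_sym oner_eq0. Qed.

Definition unit_graph : wgraph R :=
  @WGraph R (seq_sub X) unit_adj (fun _ _ => 1) unit_adj_sym unit_adj_irr
    (fun _ _ _ => erefl) (fun _ _ _ => ltr01).

End UnitGraph.

Lemma sqrt_eq1 (s : R) : 0 <= s -> (Num.sqrt s = 1) <-> (s = 1).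
Proof.
move=> s0; split=> [h|->]; last exact: sqrtr1.
by rewrite -(sqr_sqrtr s0) h expr1n.
Qed.

Lemma sqrod_unit_distance_rod (s : R) : sqrod d s ->
  exists G : wgraph R, unit_distance_rod d G (Num.sqrt s).
Proof.
case=> X [u [v [gX uX vX uv hX]]]; exists (unit_graph X); split; last by [].
split.
  exists (SeqSub uX), (SeqSub vX) => phi ephi.
  (* Gadgets quantify over maps of the whole space, so [phi] is extended by the dummy value 0
     outside [X]. *)
  pose psi (x : 'rV[R]_d) := oapp phi 0 (insub x).
  have psiE (x : seq_sub X) : psi (val x) = phi x by rewrite /psi valK.
  rewrite edistE -(psiE (SeqSub uX)) -(psiE (SeqSub vX)) hX // => x y xX yX xy.
  rewrite -[x]/(val (SeqSub xX)) -[y]/(val (SeqSub yX)) !psiE.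
  apply/sqrt_eq1; first exact: sqd_ge0.
  by rewrite -edistE; apply: ephi; apply/eqP.
exists val; split=> [x y /eqP xy|]; first by rewrite edistE xy sqrtr1.
split=> [|x y _ nxy|x y z xy yz xz /collinear_gap/eqP]; first exact: val_inj.
  rewrite edistE => /sqrt_eq1 h; case/negP: nxy; apply/eqP/h; exact: sqd_ge0.
by apply/negP; apply: gX; rewrite ?(inj_eq val_inj) //; exact: valP.
Qed.

End Rods.

Theorem theorem2 (R : realType) (d : nat) (hd : (3 <= d)%N) (a b : R)
    (ha : 0 < a) (hab : a < b) :
  exists l : R, (a < l /\ l < b) /\
    exists G : wgraph R, unit_distance_rod d G l.
Proof.
have b0 : 0 < b := lt_trans ha hab.
have [||s /andP[as_ sb] rs] := @sqrod_dense R d hd (a ^+ 2) (b ^+ 2).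
- by rewrite exprn_gt0.
- by rewrite ltr_pXn2r // ?nnegrE ltW.
exists (Num.sqrt s); split; last exact: sqrod_unit_distance_rod.
have s0 : 0 < s by rewrite (lt_trans _ as_) // exprn_gt0.
split.
  by rewrite -[a]ger0_norm ?(ltW ha) // -sqrtr_sqr ltr_sqrt.
by rewrite -[b]ger0_norm ?(ltW b0) // -sqrtr_sqr ltr_sqrt // exprn_gt0.
Qed.
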